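(* Let $X$ be an infinite-dimensional Banach space and let $\Lambda\leq X$ be a cobounded lattice, and consider the Diophantine space $(X,\mathbb{Q}\Lambda,H_{\mathrm{std}})$. For any nonincreasing function $\psi:(0,+\infty)\to(0,+\infty)$ with $\psi(q)\to 0$ as $q\to+\infty$, the Hausdorff dimension of $\mathrm{WA}_\psi$ is $+\infty$. In fact, for any nondecreasing function $f:(0,+\infty)\to(0,+\infty)$, $\mathcal{H}^f(\mathrm{WA}_\psi)=+\infty$.
   Context: Banach spaces are real. A lattice in a Banach space $X$ is a subgroup $\Lambda\leq X$ which is topologically discrete (equivalently $\min_{p\in\Lambda\setminus\{0\}}\|p\|>0$) and such that $\mathbb{R}\Lambda$ is dense in $X$, or equivalently, no proper closed subspace of $X$ contains $\Lambda$. $\Lambda$ is cobounded if its codiameter $\mathrm{codiam}(\Lambda):=\sup\{\mathrm{dist}(x,\Lambda):x\in X\}$ is finite. $\mathbb{Q}\Lambda=\{p/q:p\in\Lambda,q\in\mathbb{N}\}$ with $\mathbb{N}=\{1,2,\ldots\}$, and $H_{\mathrm{std}}(r)=\min\{q\in\mathbb{N}:qr\in\Lambda\}$ for $r\in\mathbb{Q}\Lambda$. $\mathrm{BA}_\psi$ is the set of $x\in X$ for which there exists $\varepsilon>0$ such that $\|r-x\|\geq\varepsilon\,\psi(H_{\mathrm{std}}(r))$ for all $r\in\mathbb{Q}\Lambda$, and $\mathrm{WA}_\psi=X\setminus\mathrm{BA}_\psi$. $\mathcal{H}^f(S)$ denotes the Hausdorff $f$-measure (with gauge function $f$) of a set $S$.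 *)

(* Defs.v *)
From HB Require Import structures.
From mathcomp Require Import all_boot all_order all_algebra.
From mathcomp Require Import all_classical all_reals all_analysis.
Import Order.TTheory GRing.Theory Num.Theory.
Import numFieldNormedType.Exports.

Set Implicit Arguments.
Unset Strict Implicit.
Unset Printing Implicit Defensive.

Local Open Scope classical_set_scope.
Local Open Scope ring_scope.

Definition linear_span (R : realType) (X : lmodType R) (A : set X) : set X :=
  [set x | exists (n : nat) (c : 'I_n -> R) (p : 'I_n -> X),
     (forall i, A (p i)) /\ x = \sum_(i < n) c i *: p i].

Definition infinite_dimensional (R : realType) (X : lmodType R) : Prop :=
  ~ exists s : seq X, linear_span [set` s] = [set: X].

Definition is_lattice (R : realType) (X : normedModType R) (L : set X) : Prop :=
  [/\ zmod_closed [in L], isolated L = L & dense (linear_span L)].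

Definition codiam (R : realType) (X : normedModType R) (L : set X) : \bar R :=
  ereal_sup [set edist_inf L x | x in [set: X]].

Definition cobounded (R : realType) (X : normedModType R) (L : set X) : Prop :=
  (codiam L < +oo)%E.

Definition rational_points (R : realType) (X : lmodType R) (L : set X)
    : set X :=
  [set r | exists (p : X) (q : nat), [/\ L p, (0 < q)%N & r = q%:R^-1 *: p]].

(* Only meaningful on [rational_points L]; elsewhere no such q exists and the
   value is the junk value 0. *)
Definition Hstd (R : realType) (X : lmodType R) (L : set X) (r : X) : nat :=
  xget 0%N [set q : nat | [/\ (0 < q)%N, L (q%:R *: r) &
    forall m : nat, (0 < m)%N -> L (m%:R *: r) -> (q <= m)%N]].

(* Badly approximable points of the Diophantine space (X, Q, H). *)
Definition BA (R : realType) (X : normedModType R) (Q : set X) (H : X -> R)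
    (psi : R -> R) : set X :=
  [set x | exists2 e : R, 0 < e &
     forall r, Q r -> e * psi (H r) <= `|r - x|].

Definition WA (R : realType) (X : normedModType R) (Q : set X) (H : X -> R)
    (psi : R -> R) : set X :=
  ~` BA Q H psi.

(* Equals -oo on the empty set. *)
Definition diam (R : realType) (X : pseudoMetricType R) (U : set X) : \bar R :=
  ereal_sup [set edist (x, y) | x in U & y in U].

(* A gauge is given on (0, +oo); for nondecreasing f it is extended to 0 by its
   right limit there, which is the infimum of its values.  In particular
   t |-> t ^ s extends by 0 if 0 < s, and by 1 if s = 0. *)
Definition gauge_ext (R : realType) (f : R -> R) (t : R) : R :=
  if 0 < t then f t else inf [set f u | u in [set u | 0 < u]].

Definition gauge_diam (R : realType) (X : pseudoMetricType R) (f : R -> R)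
    (U : set X) : R :=
  if U == set0 then 0 else gauge_ext f (fine (diam U)).

Definition hausdorff_premeasure (R : realType) (X : pseudoMetricType R)
    (f : R -> R) (delta : R) (S : set X) : \bar R :=
  ereal_inf [set (\sum_(0 <= n <oo) (gauge_diam f (U n))%:E)%E
            | U in [set U : nat -> set X |
                S `<=` \bigcup_n U n /\ forall n, (diam (U n) <= delta%:E)%E]].

(* The premeasures increase as delta decreases to 0, so that their limit is
   their supremum. *)
Definition hausdorff_measure (R : realType) (X : pseudoMetricType R)
    (f : R -> R) (S : set X) : \bar R :=
  ereal_sup [set hausdorff_premeasure f delta S | delta in [set d : R | 0 < d]].

Definition hausdorff_dim (R : realType) (X : pseudoMetricType R) (S : set X)
    : \bar R :=
  ereal_inf [set s%:E | s in
    [set s : R | 0 <= s /\ hausdorff_measure (fun t => t `^ s) S = 0%E]].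

(* Main.v *)
Require Import Defs.
From HB Require Import structures.
From mathcomp Require Import all_boot all_order all_algebra.
From mathcomp Require Import all_classical all_reals all_analysis.
From mathcomp Require Import lra.
Import Order.TTheory GRing.Theory Num.Theory.
Import numFieldNormedType.Exports.
Local Open Scope classical_set_scope.
Local Open Scope ring_scope.

(** The set of well approximable points contains a Cantor set all of whose nodes
    have infinitely many children, and such a set is too large to be measured by
    any gauge.

    Infinitely many children are available because the lattice has infinitely
    many vectors of norm at most some M ([infinite_short_vectors]).  Otherwise
    coboundedness would make the unit ball covered by finitely many balls of
    radius 1/2 centred at multiples of lattice vectors; iterating this
    approximation writes every vector as a dyadic series in these finitely many
    centres, so that they span the space ([linear_span_half_net]).

    The Cantor set is built from rational points r with Q_k r in the lattice,
    each surrounded by a closed ball of radius s_k.  The children of r are the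
    points r + p / m_k, where p runs over the short lattice vectors and m_k is
    large compared with M / s_k.  Every child has denominator dividing
    Q_(k+1) = m_k Q_k, and distinct children are at least c / m_k apart, where c
    is the minimal distance in the lattice.  Both numbers depend on the level
    only, and so does the radius s_(k+1), which can therefore be chosen much
    smaller than c / m_k and than psi(Q_(k+1)) ([approximation_levels]).  A point
    in balls of all levels is then well approximable
    ([WA_of_fast_approximations]).

    Now let sets U_n of small diameters cover this Cantor set with a finite sum
    of the f(diam U_n) ([hausdorff_measure_branching]).  As f > 0 is
    nondecreasing, for each e > 0 only finitely many U_n have diameter at least
    e.  Going down the tree, at each level finitely many further sets U_n have to
    be avoided, each of them so small that it meets the ball of at most one child
    of the current node; one of the infinitely many children avoids them all.
    The branch so obtained converges to a point of the Cantor set in no U_n.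
    Hence every such sum is infinite.  The gauges t^s then give the infinite
    dimension. *)

(** * Infinitely branching Cantor sets have infinite Hausdorff measure *)

Lemma normB_lt_diam {R : realType} {X : normedModType R} [U : set X] [e : R]
    [x y : X] :
  (diam U < e%:E)%E -> U x -> U y -> `|x - y| < e.
Proof.
move=> Ue Ux Uy.
have /edist_lt_ball : (edist (x, y) < e%:E)%E.
  by apply: le_lt_trans Ue; apply: ereal_sup_ubound; exists x => //; exists y.
by rewrite -ball_normE.
Qed.

(** Finitely many sets with at most one element each do not exhaust the natural
    numbers.  Below, [E n] collects the children whose ball meets the [n]-th set
    of a cover. *)
Lemma exists_outside_singletons [E : nat -> set nat] (N : nat) :
  (forall n i j, E n i -> E n j -> i = j) ->
  exists i, forall n, (n < N)%N -> ~ E n i.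
Proof.
move=> E_inj.
(* For the induction, all large numbers, and not just one, have to be outside. *)
suff [M HM] : exists M, forall i, (M <= i)%N -> forall n, (n < N)%N -> ~ E n i.
  by exists M; exact: HM.
elim: N => [|N [M HM]]; first by exists 0%N.
have [[i0 Ei0]|noE] := pselect (exists i, E N i); last first.
  exists M => i Mi n; rewrite ltnS leq_eqVlt => /predU1P[->|/(HM _ Mi)//] ENi.
  by apply: noE; exists i.
exists (maxn M i0.+1) => i; rewrite geq_max => /andP[Mi i0i] n.
rewrite ltnS leq_eqVlt => /predU1P[->|/(HM _ Mi)//] ENi.
by move: i0i; rewrite (E_inj _ _ _ Ei0 ENi) ltnn.
Qed.

Section gauge.
Context {R : realType} {X : pseudoMetricType R} (f : R -> R).
Hypotheses (f_gt0 : forall t : R, 0 < t -> 0 < f t)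
  (f_nd : forall t t' : R, 0 < t -> t <= t' -> f t <= f t').

Lemma gauge_diam_ge0 (U : set X) : 0 <= gauge_diam f U.
Proof.
rewrite /gauge_diam; case: ifP => // _; rewrite /gauge_ext.
case: ifPn => [/f_gt0/ltW//|_].
by apply: lb_le_inf => [|_ [u u0 <-]]; [exists (f 1), 1 => /= | exact/ltW/f_gt0].
Qed.

(** Finiteness of the diameter excludes the empty set, whose diameter is -oo and
    whose gauge is 0. *)
Lemma le_gauge_diam (U : set X) (e : R) : 0 < e ->
  diam U \is a fin_num -> (e%:E <= diam U)%E -> f e <= gauge_diam f U.
Proof.
move=> e0 Ufin; rewrite -[diam U]fineK// lee_fin => eU.
rewrite /gauge_diam; case: ifPn => [/eqP U0|_].
  move: Ufin; rewrite U0 /diam.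
  suff -> : [set edist (x, y) | x in (@set0 X) & y in set0] = set0.
    by rewrite ereal_sup0.
  by apply/seteqP; split => // z [x []].
by rewrite /gauge_ext (lt_le_trans e0 eU); exact: f_nd.
Qed.

End gauge.

(** [P k] is the set of possible nodes of level [k] of a tree, and the points of
    the Cantor set are those lying, for every [k], in the closed ball of radius
    [s k] about some node of level [k].  It is essential that [s] and [d] depend on
    the level and not on the node: the sets of the cover which the ball of the
    node of level [k + 1] must avoid because of their size are those of diameter at
    least [d k.+1], and this finite collection has to be known before that node is
    chosen among infinitely many candidates. *)
Lemma hausdorff_measure_branching {R : realType} {X : completeNormedModType R}
    [S : set X] (P : nat -> set X) (s d : nat -> R) :
  P 0%N !=set0 ->
  (forall k, 0 <= s k) -> s @ \oo --> 0 ->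
  (forall k, 0 < d k) ->
  (forall k r, P k r -> exists a : nat -> X, forall i,
    [/\ P k.+1 (a i), `|r - a i| + s k.+1 <= s k &
        forall j, i != j -> d k + 2 * s k.+1 <= `|a i - a j|]) ->
  (forall x, (forall k, exists2 r, P k r & `|r - x| <= s k) -> S x) ->
  forall f : R -> R,
    (forall t : R, 0 < t -> 0 < f t) ->
    (forall t t' : R, 0 < t -> t <= t' -> f t <= f t') ->
    hausdorff_measure f S = +oo%E.
Proof.
move=> [r0 Pr0] s_ge0 s_cvg0 d_gt0 branch limS f f_gt0 f_nd.
apply/eqP; rewrite -leye_eq; apply: ereal_sup_ge.
exists (hausdorff_premeasure f (d 0%N / 2) S).
  by exists (d 0%N / 2) => //=; rewrite divr_gt0.
apply: le_ereal_inf_tmp => _ [U [SU Ud] <-]; rewrite leye_eq.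
apply/negP => /negP; rewrite -ltey => sum_fin.
have gauge0 : gauge_diam f (U n) @[n --> \oo] --> 0.
  apply: cvg_series_cvg_0; apply: nnseries_is_cvg sum_fin => i.
  exact: gauge_diam_ge0.
(* The terms of a convergent series tend to 0, so the gauges do, and [f e] bounds
   from below the gauge of every set of diameter at least [e]. *)
have large e : 0 < e ->
    exists N, forall n, (N <= n)%N -> (diam (U n) < e%:E)%E.
  move=> e0; have /cvgrPdist_lt/(_ (f e) (f_gt0 _ e0))[N _ HN] := gauge0.
  exists N => n /HN; rewrite sub0r normrN ger0_norm; last exact: gauge_diam_ge0.
  move=> small; rewrite ltNge; apply/negP => eU.
  move: small; rewrite ltNge le_gauge_diam// fin_numE.
  rewrite gt_eqF ?lt_eqF// ?(le_lt_trans (Ud n)) ?ltry//.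
  by rewrite (lt_le_trans _ eU) ?ltNyr.
pose misses n k r := forall y, U n y -> s k < `|r - y|.
(* The middle condition deals with sets that are smaller than every [d k], such as
   singletons. *)
pose good k r := [/\ P k r, forall n, (n < k)%N -> misses n k r &
  forall n, ((d k)%:E <= diam (U n))%E -> misses n k r].
have good0 : good 0%N r0.
  split=> // n dU; move: (le_trans dU (Ud n)); rewrite lee_fin.
  by rewrite leNgt ltr_pdivrMr// mulr_natr mulr2n ltrDl d_gt0.
have step (kr : nat * X) : exists r', good kr.1 kr.2 ->
    good kr.1.+1 r' /\ `|kr.2 - r'| + s kr.1.+1 <= s kr.1.
  case: kr => k r /=.
  have [[Pr old big]|nogood] := pselect (good k r); last by exists 0 => /nogood.
  have [a Ha] := branch k r Pr.
  have [N HN] := large _ (d_gt0 k.+1).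
  pose E n i := (diam (U n) < (d k)%:E)%E /\
    exists2 y, U n y & `|a i - y| <= s k.+1.
  (* Points in the balls of two different children are at least [d k] apart. *)
  have E_inj n i j : E n i -> E n j -> i = j.
    move=> [Unk [y Uy ay]] [_ [z Uz az]].
    apply/eqP; apply/negP => /negP ij.
    have [_ _ /(_ _ ij)] := Ha i; apply/negP; rewrite -ltNge.
    have -> : a i - a j = (a i - y) + (y - z) - (a j - z).
      by rewrite addrA subrK opprB addrA subrK.
    apply: (le_lt_trans (ler_normB _ _)).
    have := ler_normD (a i - y) (y - z).
    have := normB_lt_diam Unk Uy Uz; lra.
  have [i Hi] := exists_outside_singletons (maxn N k.+1) E_inj.
  have [Pai nest _] := Ha i.
  (* The larger sets miss the ball of the parent, which contains that of the
     child; the smaller ones miss the latter by the choice of [i]. *)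
  have missed n : (n < maxn N k.+1)%N -> misses n k.+1 (a i).
    move=> nN y Uy; have [dU|dU] := leP (d k)%:E (diam (U n)).
      have := big n dU y Uy; have := ler_distD (a i) r y; lra.
    by rewrite ltNge; apply/negP => ay; apply: (Hi n nN); split=> //; exists y.
  exists (a i) => _; split=> //; split=> // n.
    by move=> nk; apply: missed; rewrite leq_max nk orbT.
  move=> dU; apply: missed; rewrite leq_max ltnNge; apply/orP; left.
  by apply/negP => /HN; rewrite ltNge dU.
have [g Hg] := choice step.
pose r := nat_rect (fun=> X) r0 (fun k x => g (k, x)).
have good_r k : good k (r k).
  by elim: k => // k IH; have [] := Hg (k, r k) IH.
have nested k n : `|r k - r (k + n)%N| + s (k + n)%N <= s k.
  elim: n => [|n IH]; first by rewrite addn0 subrr normr0 add0r.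
  have [_] := Hg ((k + n)%N, r (k + n)%N) (good_r _).
  rewrite addnS /= -/(r _) => nest.
  have := ler_distD (r (k + n)%N) (r k) (g ((k + n)%N, r (k + n)%N)).
  by move: nest IH; lra.
have near_r k j : (k <= j)%N -> `|r k - r j| <= s k.
  move=> /subnKC <-; have := nested k (j - k)%N.
  by have := s_ge0 (k + (j - k))%N; lra.
have /cauchy_cvgP r_cvg : cauchy (r @ \oo).
  apply: cauchy_exP => e e0.
  have /cvgrPdist_lt/(_ e e0)[K _ /(_ K (leqnn _))] := s_cvg0.
  rewrite /= sub0r normrN ger0_norm// => sK.
  exists (r K), K => // j /= Kj; rewrite -ball_normE /=.
  by apply: le_lt_trans sK; exact: near_r.
pose x := lim (r @ \oo).
have near_x k : `|r k - x| <= s k.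
  apply: (@cvgr_to_le _ (\oo) _ _ (fun j => `|r k - r j|)).
    by apply: cvg_norm; apply: cvgB r_cvg; exact: cvg_cst.
  by exists k => // j; exact: near_r.
have /SU[n _ Unx] : S x.
  by apply: limS => k; exists (r k) => //; case: (good_r k).
have [_ /(_ n (leqnn _) _ Unx) + _] := good_r n.+1.
by rewrite ltNge near_x.
Qed.

Lemma hausdorff_dim_pinfty {R : realType} {X : pseudoMetricType R} [S : set X] :
  (forall f : R -> R,
    (forall t : R, 0 < t -> 0 < f t) ->
    (forall t t' : R, 0 < t -> t <= t' -> f t <= f t') ->
    hausdorff_measure f S = +oo%E) ->
  hausdorff_dim S = +oo%E.
Proof.
move=> HfS; rewrite /hausdorff_dim; set A := (X in ereal_inf X).
suff -> : A = set0 by rewrite ereal_inf0.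
apply/seteqP; split=> // z [s [s0 +] _]; rewrite HfS// => [t|t t'] t0.
  exact: powR_gt0.
by move=> tt'; rewrite ge0_ler_powR// nnegrE ?(le_trans _ tt')// ltW.
Qed.

(** * Bounded vectors of a cobounded lattice *)

(** Writing y = v + z / 2 with [v] in [F] and z again in the unit ball, and
    iterating, expands y as a series of terms v_k / 2^k.  Collecting the terms with
    the same v_k leaves a finite combination of vectors of [F] whose coefficients
    are absolutely convergent real series.  Thus y lies in the span itself, and not
    merely in its closure. *)
Lemma linear_span_half_net {R : realType} {X : normedModType R} [F : seq X] :
  (forall y, `|y| <= 1 -> exists2 v, v \in F & `|y - v| <= 2^-1) ->
  linear_span [set` F] = [set: X].
Proof.
move=> net; apply/seteqP; split=> // x0 _.
(* Adding 1 to the norm spares a separate treatment of the zero vector. *)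
have t_gt0 : 0 < `|x0| + 1 by rewrite ltr_wpDl.
pose x := (`|x0| + 1)^-1 *: x0.
have x_le1 : `|x| <= 1.
  by rewrite normrZ gtr0_norm ?invr_gt0// mulrC ler_pdivrMr// mul1r lerDl.
have /choice[g Hg] y :
    exists v, `|y| <= 1 -> v \in F /\ `|y - v| <= 2^-1.
  have [/net[v vF yv]|y1] := pselect (`|y| <= 1).
    by exists v.
  by exists 0 => /y1.
(* [y n] is the remainder after [n] terms, rescaled to the unit ball; [c v n] is
   the coefficient of [v] in the sum of these terms. *)
pose y n := iter n (fun z => 2 *: (z - g z)) x.
have y_le1 n : `|y n| <= 1.
  elim: n => //= n IH; have [_] := Hg _ IH.
  rewrite normrZ ger0_norm// -(ler_pM2l (_ : 0 < 2 :> R))// divff//.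
pose c v n : R := \sum_(0 <= k < n) (g (y k) == v)%:R * 2^-1 ^+ k.
have expand n : x = \sum_(v <- undup F) c v n *: v + 2^-1 ^+ n *: y n.
  have -> : \sum_(v <- undup F) c v n *: v = \sum_(0 <= k < n) 2^-1 ^+ k *: g (y k).
    under eq_bigr do rewrite scaler_suml.
    rewrite exchange_big; apply: eq_bigr => k _.
    have gF : g (y k) \in undup F by rewrite mem_undup; case: (Hg _ (y_le1 k)).
    rewrite (bigD1_seq _ gF (undup_uniq F))/= eqxx mul1r big1 ?addr0// => v.
    by rewrite eq_sym => /negPf ->; rewrite mul0r scale0r.
  elim: n => [|n IH]; first by rewrite big_geq// add0r expr0 scale1r.
  rewrite {1}IH big_nat_recr//= scalerA exprSr -mulrA mulVf// mulr1.
  by rewrite -addrA -scalerDr (addrC (g _)) subrK.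
have c_cvg v : cvgn (c v).
  apply: nondecreasing_is_cvgn.
    apply/nondecreasing_seqP => n.
    by rewrite /c big_nat_recr//= lerDl mulr_ge0// exprn_ge0.
  (* 2 - 2 / 2^n is the sum of all the weights 2^-k with k < n. *)
  exists 2 => _ [n _ <-]; suff : c v n <= 2 - 2 * 2^-1 ^+ n.
    by have := exprn_ge0 n (_ : 0 <= 2^-1 :> R); rewrite invr_ge0 ler0n => /(_ isT); lra.
  elim: n => [|n IH]; first by rewrite /c big_geq// expr0; lra.
  rewrite /c big_nat_recr//= -/(c v n) exprS.
  have := exprn_ge0 n (_ : 0 <= 2^-1 :> R); rewrite invr_ge0 ler0n => /(_ isT).
  by case: (_ == _) => /=; lra.
have xE : x = \sum_(v <- undup F) lim (c v @ \oo) *: v.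
  have sum_cvg : \sum_(v <- undup F) c v n *: v @[n --> \oo] -->
      \sum_(v <- undup F) lim (c v @ \oo) *: v.
    apply: cvg_big => [|v _]; first exact: add_continuous.
    by apply: cvgZr_tmp; exact: c_cvg.
  apply: (cvg_unique (@norm_hausdorff _ _) _ sum_cvg).
  apply/cvgrPdist_lt => e e0.
  have : geometric 1 2^-1 n @[n --> \oo] --> (0 : R).
    by apply: cvg_geometric; rewrite ger0_norm ?invf_lt1// ltr1n.
  move=> /cvgr0Pnorm_lt/(_ e e0); apply: filterS => n /=.
  rewrite mul1r {1}(expand n) addrAC subrr add0r normrZ; apply: le_lt_trans.
  by rewrite ler_piMr// normr_ge0.
exists (size (undup F)).
exists (fun i => (`|x0| + 1) * lim (c (undup F)`_i @ \oo)).
exists (fun i => (undup F)`_i); split.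
  by move=> i; rewrite /= -mem_undup mem_nth.
under eq_bigr do rewrite -scalerA.
pose term v := lim (c v @ \oo) *: v.
rewrite -scaler_sumr -(big_mkord xpredT (fun i => term (undup F)`_i)).
by rewrite -(big_nth 0 xpredT term) -xE scalerA mulfV ?gt_eqF// scale1r.
Qed.

(** With C bounding the distances to [L], the ball of radius 2C lies within C of
    the lattice vectors of norm at most 3C.  Rescaled by 1 / (2C), this is the
    hypothesis of [linear_span_half_net], as soon as these vectors are finitely
    many. *)
Lemma infinite_short_vectors {R : realType} {X : normedModType R} [L : set X] :
  infinite_dimensional X -> cobounded L ->
  exists2 M : R, 0 < M & infinite_set [set p | L p /\ `|p| <= M].
Proof.
move=> infdim; rewrite /cobounded => cob.
have [C C0 near_L] : exists2 C : R, 0 < C &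
    forall x, exists2 p, L p & `|x - p| <= C.
  have [C C0 codiamC] : exists2 C : R, 0 < C & (codiam L < C%:E)%E.
    case: (codiam L) cob => [r|//|] _; last by exists 1; rewrite ?ltNyr.
    exists (`|r| + 1); first by rewrite ltr_wpDl.
    by rewrite lte_fin (le_lt_trans (ler_norm r))// ltrDl.
  exists C => // x.
  have : (edist_inf L x < C%:E)%E.
    by apply: le_lt_trans codiamC; apply: ereal_sup_ubound; exists x.
  move=> /ereal_inf_lt[_ [p Lp <-]] /edist_lt_ball.
  by rewrite -ball_normE /= => /ltW xp; exists p.
exists (3 * C); first by rewrite mulr_gt0.
set A := [set p | _] => /(finite_image (fun p => (2 * C)^-1 *: p)).
move=> /finite_seqP[F AF]; apply: infdim; exists F.
apply: linear_span_half_net => y y1.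
have [p Lp yp] := near_L ((2 * C) *: y).
have C2 : 0 < 2 * C by rewrite mulr_gt0.
exists ((2 * C)^-1 *: p).
  have : [set` F] ((2 * C)^-1 *: p); last by [].
  rewrite -AF; exists p => //; split=> //.
  have := ler_normB ((2 * C) *: y) ((2 * C) *: y - p).
  rewrite opprB addrC subrK normrZ gtr0_norm// => /le_trans; apply.
  have : 2 * C * `|y| <= 2 * C by rewrite ler_piMr// ltW.
  lra.
have -> : y - (2 * C)^-1 *: p = (2 * C)^-1 *: ((2 * C) *: y - p).
  by rewrite scalerBr scalerA mulVf ?gt_eqF// scale1r.
by rewrite normrZ gtr0_norm ?invr_gt0// mulrC ler_pdivrMr// mulrA mulVf// mul1r.
Qed.

(** In a subgroup, isolatedness of 0 is uniform discreteness. *)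
Lemma lattice_separated {R : realType} {X : normedModType R} [L : set X] :
  is_lattice L ->
  exists2 c : R, 0 < c & forall p q, L p -> L q -> p != q -> c <= `|p - q|.
Proof.
move=> [[L0 LB] Liso _].
have : isolated L 0 by rewrite Liso; move: L0; rewrite inE.
move=> [_ [V /nbhs_ballP[c c0 cV] VL]]; exists c => // p q Lp Lq.
apply: contra_neqT; rewrite -ltNge => pqc.
suff : (V `&` L) (p - q) by rewrite VL => /eqP; rewrite subr_eq0 => /eqP.
split; last by have := LB p q; rewrite !inE; apply.
by apply: cV; rewrite -ball_normE /= sub0r normrN.
Qed.

(** * Rational points and their heights *)

Lemma lattice_lincomb {R : realType} {X : lmodType R} [L : set X] (m n : nat)
    [p q : X] :
  zmod_closed [in L] -> L p -> L q -> L (m%:R *: p + n%:R *: q).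
Proof.
move=> [L0 LB].
have LN u : L u -> L (- u).
  by move=> Lu; have := LB 0 u L0; rewrite !inE sub0r; apply.
have LD u v : L u -> L v -> L (u + v).
  by move=> Lu /LN Lv; have := LB u (- v); rewrite !inE opprK; apply.
have LM u k : L u -> L (k%:R *: u).
  move=> Lu; elim: k => [|k IH]; first by rewrite scale0r; move: L0; rewrite inE.
  by rewrite -addn1 natrD scalerDl scale1r; apply: LD.
by move=> Lp Lq; apply: LD; exact: LM.
Qed.

Lemma Hstd_le {R : realType} {X : lmodType R} [L : set X] [r : X] [q : nat] :
  (0 < q)%N -> L (q%:R *: r) -> (0 < Hstd L r <= q)%N.
Proof.
move=> q0 Lq; rewrite /Hstd; case: xgetP => [n _ [n0 Ln min_n]|none].
  by rewrite n0 min_n.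
have ex : exists n, (0 < n)%N && `[< L (n%:R *: r) >].
  by exists q; rewrite q0; apply/asboolP.
exfalso; case: (ex_minnP ex) => n /andP[n0 /asboolP Ln] min_n.
apply: (none n); split=> // m m0 Lm; apply: min_n.
by rewrite m0; apply/asboolP.
Qed.

(** The denominators [Q k] only bound the heights of the approximations from above,
    which suffices because [psi] is nonincreasing.  The factor 1 / (k + 1) beats
    every constant [e] of badly approximable points. *)
Lemma WA_of_fast_approximations {R : realType} {X : normedModType R} [L : set X]
    [psi : R -> R] [Q : nat -> nat] [x : X] :
  (forall q, 0 < q -> 0 < psi q) ->
  (forall q q', 0 < q -> q <= q' -> psi q' <= psi q) ->
  (forall k, (0 < Q k)%N) ->
  (forall k, exists2 r, L ((Q k)%:R *: r) &
     `|r - x| <= psi (Q k)%:R / k.+1%:R) ->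
  WA (rational_points L) (fun r => (Hstd L r)%:R) psi x.
Proof.
move=> psi_gt0 psi_noninc Q_gt0 approx [e e0 far].
pose k := Num.bound e^-1; have [r Lr rx] := approx k.
have ek : e^-1 < k.+1%:R.
  by rewrite (lt_trans (archi_boundP _))// ?ltr_nat// invr_ge0 ltW.
have QR0 : (0 : R) < (Q k)%:R by rewrite ltr0n.
have /far : rational_points L r.
  exists ((Q k)%:R *: r), (Q k); split=> //.
  by rewrite scalerA mulVf ?gt_eqF// scale1r.
apply/negP; rewrite -ltNge; apply: (le_lt_trans rx).
have /andP[H0 HQ] := Hstd_le (Q_gt0 k) Lr.
apply: (@lt_le_trans _ _ (e * psi (Q k)%:R)).
  by rewrite mulrC ltr_pM2r ?psi_gt0// invf_plt ?posrE ?ltr0n.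
by rewrite ler_pM2l// psi_noninc ?ltr0n ?ler_nat.
Qed.

(** * The levels of the Cantor set, and the theorem *)

(** The numerical skeleton of the construction: [Q k] is a common denominator and
    [s k] the radius at level [k], and the children of a node are its translates by
    short lattice vectors, of norm at most [M], divided by [m k].  The last two
    inequalities make the balls of the children lie in that of the parent, and be
    small compared with the distance [c / m k] between the children. *)
Lemma approximation_levels {R : realType} [psi : R -> R] [M c : R] :
  (forall q, 0 < q -> 0 < psi q) -> 0 < M -> 0 < c ->
  exists (Q m : nat -> nat) (s : nat -> R), forall k,
    [/\ (0 < Q k)%N /\ (0 < m k)%N, Q k.+1 = (m k * Q k)%N, 0 < s k,
        s k <= k.+1%:R^-1 /\ s k <= psi (Q k)%:R / k.+1%:R &
        M / (m k)%:R + s k.+1 <= s k /\ 4 * s k.+1 <= c / (m k)%:R].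
Proof.
move=> psi_gt0 M_gt0 c_gt0.
pose m (s : R) := Num.bound (2 * M / s).
(* [cap] makes the radii tend to 0 and stay below psi (Q k) / (k + 1). *)
pose cap k q : R := Num.min 1 (psi q%:R) / k.+1%:R.
pose next k (Qs : nat * R) : nat * R :=
  let Q' := (m Qs.2 * Qs.1)%N in
  (Q', Num.min (cap k.+1 Q') (Num.min (Qs.2 / 2) (c / (m Qs.2)%:R / 4))).
pose lev := nat_rect (fun=> (nat * R)%type) (1%N, cap 0%N 1%N) next.
have cap_gt0 k q : (0 < q)%N -> 0 < cap k q.
  by move=> q0; rewrite divr_gt0// lt_min ltr01 psi_gt0// ltr0n.
have m_large s : 0 < s -> 2 * M / s < (m s)%:R.
  by move=> s0; apply: archi_boundP; rewrite divr_ge0 ?mulr_ge0 ?ltW.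
have m_gt0 s : 0 < s -> (0 < m s)%N.
  move=> s0; rewrite -(ltr0n R); apply: le_lt_trans (m_large _ s0).
  by rewrite divr_ge0 ?mulr_ge0 ?ltW.
have lev_pos k : [/\ (0 < (lev k).1)%N, 0 < (lev k).2 & (lev k).2 <= cap k (lev k).1].
  elim: k => [|k [Q0 s0 _]]; first by split=> //; exact: cap_gt0.
  have Q'0 : (0 < m (lev k).2 * (lev k).1)%N by rewrite muln_gt0 m_gt0.
  split=> //=; last by rewrite ge_min lexx.
  by rewrite !lt_min cap_gt0//= !divr_gt0// ltr0n m_gt0.
exists (fun k => (lev k).1), (fun k => m (lev k).2), (fun k => (lev k).2) => k.
have [Q0 s0 s_cap] := lev_pos k.
have [m0 ms] := (m_gt0 _ s0, m_large _ s0).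
have mR0 : 0 < (m (lev k).2)%:R :> R by rewrite ltr0n.
split=> //.
  split; apply: (le_trans s_cap).
    by rewrite ler_pdivrMr// mulVf ?pnatr_eq0// ge_min lexx.
  by rewrite ler_pM2r ?invr_gt0 ?ltr0n// ge_min lexx orbT.
have [sh sc] : (lev k.+1).2 <= (lev k).2 / 2 /\
    (lev k.+1).2 <= c / (m (lev k).2)%:R / 4.
  by rewrite /=; split; rewrite !ge_min lexx ?orbT.
split; last by move: sc; set u := c / _; lra.
have : M / (m (lev k).2)%:R <= (lev k).2 / 2.
  by move: ms; rewrite !ltr_pdivrMr// ler_pdivrMr// => /ltW; lra.
lra.
Qed.

Theorem theorem4p6 (R : realType) (X : completeNormedModType R) (L : set X)
    (psi : R -> R)
    (X_infdim : infinite_dimensional X)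
    (L_lattice : is_lattice L) (L_cobounded : cobounded L)
    (psi_gt0 : forall q : R, 0 < q -> 0 < psi q)
    (psi_noninc : forall q q' : R, 0 < q -> q <= q' -> psi q' <= psi q)
    (psi_cvg0 : psi q @[q --> +oo] --> 0) :
  let WA_psi := WA (rational_points L) (fun r => (Hstd L r)%:R) psi in
  hausdorff_dim WA_psi = +oo%E /\
  forall f : R -> R,
    (forall t : R, 0 < t -> 0 < f t) ->
    (forall t t' : R, 0 < t -> t <= t' -> f t <= f t') ->
    hausdorff_measure f WA_psi = +oo%E.
Proof.
move=> WA_psi.
suff HfWA : forall f : R -> R,
    (forall t : R, 0 < t -> 0 < f t) ->
    (forall t t' : R, 0 < t -> t <= t' -> f t <= f t') ->
    hausdorff_measure f WA_psi = +oo%E.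
  by split=> //; exact: hausdorff_dim_pinfty.
have [L_zmod _ _] := L_lattice.
have [c c0 L_sep] := lattice_separated L_lattice.
have [M M0 /infiniteP/pcard_leP[p]] := infinite_short_vectors X_infdim L_cobounded.
have p_short i : L (p i) /\ `|p i| <= M by apply: (@funS _ _ _ _ p).
have p_inj i j : i != j -> p i != p j.
  by apply: contra_neq => pij; apply: ('inj_p); rewrite ?inE.
(* [c / m k] separates the children; half of it is left between their balls. *)
have [Q [m [s levels]]] := approximation_levels psi_gt0 M0 c0.
apply: (hausdorff_measure_branching (fun k r => L ((Q k)%:R *: r)) s
  (fun k => c / (m k)%:R / 2)).
- by exists 0; rewrite scaler0; case: L_zmod; rewrite inE.
- by move=> k; have [_ _ /ltW] := levels k.
- apply: (squeeze_cvgr _ (cvg_cst 0) cvg_harmonic).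
  by near=> k; have [_ _ /ltW-> [-> _] _] := levels k.
- by move=> k; have [[_ m0] _ _ _ _] := levels k; rewrite !divr_gt0// ltr0n.
- move=> k r Lr; have [[Q0 m0] QS _ _ [nest sep]] := levels k.
  have mR0 : (0 : R) < (m k)%:R by rewrite ltr0n.
  exists (fun i => r + (m k)%:R^-1 *: p i) => i; have [Lpi piM] := p_short i.
  split=> [||j ij].
  + have -> : (Q k.+1)%:R *: (r + (m k)%:R^-1 *: p i) =
        (m k)%:R *: ((Q k)%:R *: r) + (Q k)%:R *: p i.
      rewrite QS natrM scalerDr -scalerA; congr (_ + _).
      by rewrite scalerA mulrAC mulfV ?mul1r// gt_eqF.
    exact: lattice_lincomb.
  + rewrite opprD addrA subrr add0r normrN normrZ gtr0_norm ?invr_gt0//.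
    apply: le_trans nest; rewrite lerD2r mulrC.
    by rewrite ler_pM2r ?invr_gt0.
  + rewrite opprD addrACA subrr add0r -scalerBr normrZ gtr0_norm ?invr_gt0//.
    have [Lpj _] := p_short j.
    have := L_sep _ _ Lpi Lpj (p_inj _ _ ij).
    rewrite -(ler_pM2l (_ : 0 < (m k)%:R^-1)) ?invr_gt0// mulrC.
    by move: sep; lra.
- move=> x approx; apply: (@WA_of_fast_approximations _ _ _ _ Q) => //.
  + by move=> k; have [[]] := levels k.
  + move=> k; have [r Lr rx] := approx k; exists r => //; apply: le_trans rx _.
    by have [_ _ _ []] := levels k.
Unshelve. all: by end_near.
Qed.
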